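(* Let $A$ be a poset with order $\le$, let $(\cdot,\to)$ be an adjunction on $A$, let $1\in A$, and let $\vee$ be a binary operation on $A$. Then the following are equivalent: (a) $A$ is a join-semilattice with join $\vee$ and $(A,\to,1)$ is a wBCK*-algebra; (b) $A$ is a join-semilattice with join $\vee$ and $(A,\cdot,1)$ is a commutative groupoid in which $1$ is a neutral element and the greatest element of $A$; (c) $A$ is a join-semilattice with join $\vee$, $\cdot$ is commutative, $1$ is a neutral element for $\cdot$ and the greatest element of $A$, and $\cdot$ distributes over $\vee$: $(x\vee y)z=xz\vee yz$ and $z(x\vee y)=zx\vee zy$ for all $x,y,z$ (i.e. $(A,\vee,\cdot,1)$ is an integral commutative multiplicative semilattice).
   Context: An adjunction on a poset $A$ is a pair $(\cdot,\to)$ of binary operations on $A$ such that for all $x,y,z$: $x\le y\to z$ iff $x\cdot y\le z$. A wBCK*-algebra is an algebra $(A,\to,1)$ where $A$ is a poset with greatest element $1$, $x\le y$ iff $x\to y=1$, and for all $x,y,z$: if $x\le y\to z$ then $y\le x\to z$. *)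

(* Defs.v *)
From Stdlib Require Import Relation_Definitions.
From Stdlib Require Import ssreflect ssrfun.

Definition adjunction (A : Type) (le : relation A) (mul imp : A -> A -> A) : Prop :=
  forall x y z : A, le x (imp y z) <-> le (mul x y) z.

Definition greatest (A : Type) (le : relation A) (t : A) : Prop :=
  forall x : A, le x t.

Definition is_join (A : Type) (le : relation A) (x y s : A) : Prop :=
  (le x s /\ le y s) /\ (forall u : A, le x u -> le y u -> le s u).

Record join_semilattice (A : Type) (le : relation A) (join : A -> A -> A) : Prop := {
  join_semilattice_order : order A le;
  join_semilattice_join : forall x y : A, is_join A le x y (join x y)
}.

(* The underlying poset is part of the data of a wBCK*-algebra, so [le] is a
   parameter and is required to be the order induced by [imp] and [one]. *)
Record wBCKstar (A : Type) (le : relation A) (imp : A -> A -> A) (one : A) : Prop := {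
  wBCKstar_order : order A le;
  wBCKstar_greatest : greatest A le one;
  wBCKstar_le_imp : forall x y : A, le x y <-> imp x y = one;
  wBCKstar_exchange : forall x y z : A, le x (imp y z) -> le y (imp x z)
}.

Definition neutral (A : Type) (mul : A -> A -> A) (e : A) : Prop :=
  left_id e mul /\ right_id e mul.

Definition distributes_over (A : Type) (mul join : A -> A -> A) : Prop :=
  left_distributive mul join /\ right_distributive mul join.

(* Main.v *)
(* An element of a poset is determined by its set of upper bounds, and the
   adjunction describes the upper bounds of [x * y] through [imp]: exchange for
   [imp] is commutativity of [mul], and [x <= y iff imp x y = 1] is neutrality
   of [1]. Distributivity holds because [_ * z] is a left adjoint. *)
Require Import Defs.
From Stdlib Require Import Relation_Definitions Setoid.
From Stdlib Require Import ssreflect ssrfun.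

Lemma eq_upper_bounds (A : Type) (le : relation A) (Hle : order A le) (x y : A) :
  (forall z, le x z <-> le y z) -> x = y.
Proof.
case: Hle => refl _ antisym xy.
by apply: antisym; [apply/xy | apply/xy]; apply: refl.
Qed.

Lemma join_le_iff (A : Type) (le : relation A) (join : A -> A -> A) :
  join_semilattice A le join ->
  forall x y z, le (join x y) z <-> le x z /\ le y z.
Proof.
move=> [[_ trans _] joinP] x y z; case: (joinP x y) => [[xj yj] jmin].
split=> [jz | [xz yz]]; last exact: jmin.
by split; [apply: trans xj jz | apply: trans yj jz].
Qed.

(** Turns an equation [imp x y = one] into the inequality [le one (imp x y)], to which the
    adjunction applies. *)
Lemma ge_greatest (A : Type) (le : relation A) (Hle : order A le) (t x : A) :
  greatest A le t -> le t x <-> x = t.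
Proof.
case: Hle => refl _ antisym tmax.
by split=> [tx | ->]; [apply: antisym | apply: refl].
Qed.

Lemma adjunction_mul_joinl (A : Type) (le : relation A)
    (mul imp join : A -> A -> A) :
  adjunction A le mul imp -> join_semilattice A le join ->
  left_distributive mul join.
Proof.
move=> adj J x y z; apply: (eq_upper_bounds A le (join_semilattice_order _ _ _ J)) => u.
(* Either side lies below [u] exactly when both [x] and [y] lie below [imp z u]. *)
by rewrite -(adj _ _ _) !(join_le_iff A le join J) !(adj _ _ _).
Qed.

Lemma wBCKstar_commutative_integral (A : Type) (le : relation A) (Hle : order A le)
    (mul imp : A -> A -> A) (Hadj : adjunction A le mul imp) (one : A) :
  wBCKstar A le imp one <->
  commutative mul /\ neutral A mul one /\ greatest A le one.
Proof.
split=> [[_ one_max le_imp exch] | [mulC [[mul1x _] one_max]]].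
- have mulC : commutative mul.
    move=> x y; apply: (eq_upper_bounds A le Hle) => z.
    (* After transposing, the two directions are exchange for [x], [y] and for [y], [x]. *)
    by rewrite -!(Hadj _ _ _); split; apply: exch.
  have mul1x : left_id one mul.
    move=> x; apply: (eq_upper_bounds A le Hle) => z.
    (* [mul one x] is below [z] iff [one] is below [imp x z], iff [imp x z = one], iff [x] is below
       [z]. *)
    by rewrite -(Hadj one x z) (le_imp x z); apply: (ge_greatest A le Hle).
  have mulx1 : right_id one mul by move=> x; rewrite mulC.
  by do ![split=> //].
- split=> // [x y | x y z].
    (* The same chain, now with [mul one x = x] given and the law for [imp] as the outcome. *)
    by rewrite -(ge_greatest A le Hle one) // (Hadj _ _ _) mul1x.
  by rewrite !(Hadj _ _ _) mulC.
Qed.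

Theorem theorem4p8 (A : Type) (le : relation A) (Hle : order A le)
    (mul imp : A -> A -> A) (Hadj : adjunction A le mul imp)
    (one : A) (join : A -> A -> A) :
  let a := join_semilattice A le join /\ wBCKstar A le imp one in
  let b := join_semilattice A le join /\
           commutative mul /\ neutral A mul one /\ greatest A le one in
  let c := join_semilattice A le join /\
           commutative mul /\ neutral A mul one /\ greatest A le one /\
           distributes_over A mul join in
  (a <-> b) /\ (b <-> c).
Proof.
move=> a b c; split.
  by rewrite /a /b (wBCKstar_commutative_integral A le Hle mul imp Hadj).
split=> [[J [mulC [mul1 one_max]]] | [J [mulC [mul1 [one_max _]]]]] //.
have mulDl := adjunction_mul_joinl A le mul imp join Hadj J.
do 5!split=> //.
(* Commutativity moves [z] to the right, where it is the fixed factor of a left adjoint. *)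
by move=> z x y; rewrite !(mulC z) mulDl.
Qed.
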